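(* There is an absolute constant $C_0<6.7129$ such that for every $n\ge1$ and every family $\eta_1,\dots,\eta_n$ of admissible measures on $\mathbb R$, \[ T\Big(\Big(\tfrac1n\sum_{i=1}^n\eta_i\Big)^{*n}\Big)\le C_0\,T(\eta_1*\cdots*\eta_n). \]
   Context: A finitely supported positive measure $\eta$ on $\mathbb R$ is called admissible if $\int_{\mathbb R}e^x\,\eta(dx)=1$ and $\int_{\mathbb R}e^{-x}\,\eta(dx)=1$. For such $\eta$, $T(\eta):=\frac12\int_{\mathbb R}|e^x-e^{-x}|\,\eta(dx)$. $*$ denotes convolution of measures and $\eta^{*n}$ the $n$-fold convolution of $\eta$ with itself. *)

(* Defs.v *)
From Stdlib Require Import Reals List.
Import ListNotations.
Open Scope R_scope.

(* A finitely supported positive measure on R is represented by a finite list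
   of atoms (x, w) meaning the measure sum_k w_k * delta_{x_k}, with w_k >= 0.
   Repeated atoms are allowed (their weights add up). *)
Definition fmeas := list (R * R).

Definition fm_positive (m : fmeas) : Prop := Forall (fun p => 0 <= snd p) m.

Definition fm_integ (f : R -> R) (m : fmeas) : R :=
  fold_right (fun p acc => snd p * f (fst p) + acc) 0 m.

Definition admissible (m : fmeas) : Prop :=
  fm_positive m /\ fm_integ exp m = 1 /\ fm_integ (fun x => exp (- x)) m = 1.

Definition T (m : fmeas) : R :=
  / 2 * fm_integ (fun x => Rabs (exp x - exp (- x))) m.

Definition fm_dirac0 : fmeas := [(0, 1)].

Definition fm_conv (m1 m2 : fmeas) : fmeas :=
  flat_map (fun p => map (fun q => (fst p + fst q, snd p * snd q)) m2) m1.

Fixpoint fm_conv_pow (m : fmeas) (n : nat) : fmeas :=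
  match n with
  | O => fm_dirac0
  | S k => fm_conv m (fm_conv_pow m k)
  end.

Definition fm_scale (c : R) (m : fmeas) : fmeas :=
  map (fun p => (fst p, c * snd p)) m.

Fixpoint fm_sum (eta : nat -> fmeas) (n : nat) : fmeas :=
  match n with
  | O => []
  | S k => fm_sum eta k ++ eta k
  end.

Fixpoint fm_conv_family (eta : nat -> fmeas) (n : nat) : fmeas :=
  match n with
  | O => fm_dirac0
  | S k => fm_conv (fm_conv_family eta k) (eta k)
  end.

(* Main.v *)
(* Since the weights [exp x] and [exp (- x)] have integral 1, [T] is linear in the measure,
   subadditive under convolution, and monotone: [T a <= T (a * b)].  Write [F w] for [T] of the
   convolution of the [eta_i] over the letters [i] of a word [w], and [t] for the value of [F] on
   the word [1 ... n].  The left side is the average of [F w] over uniform words [w] of length [n].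
   Split [w] into layers, the [k]-th being the set of letters occurring at least [k] times.  Every
   layer costs at most [t].  For [k >= 6] there is a gain: after averaging over permutations of the
   letters, a layer of size [s] can be replaced by any of [m = n / s] disjoint blocks [B_j], and a
   Riesz product test function gives [F B_1 + ... + F B_m <= 4 sqrt m F (B_1 ... B_m)] as soon as
   [t < 1/4] (otherwise [T <= 1] suffices).  As the expectation of [4 ^ (number of occurrences)]
   of a letter is at most [27], the layers [k >= 6] contribute less than [t] altogether, so
   [C0 = 6] works. *)

From HB Require Import structures.
From mathcomp Require all_boot perm.
Require Import Defs.
From Stdlib Require Import Reals List Permutation Lra.
Open Scope R_scope.

Local Arguments fm_conv : simpl never.
Local Arguments fm_dirac0 : simpl never.

(** * Integrals against finite measures, and the algebra of convolution *)

Lemma fm_integ_ext f g m : (forall x, f x = g x) -> fm_integ f m = fm_integ g m.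
Proof. intros H; induction m as [|p m IH]; simpl; [|rewrite H, IH]; reflexivity. Qed.

Lemma fm_integ_app f a b : fm_integ f (a ++ b) = fm_integ f a + fm_integ f b.
Proof. induction a as [|p a IH]; simpl; [|rewrite IH]; ring. Qed.

Lemma fm_integ_linear c d f g m :
  fm_integ (fun x => c * f x + d * g x) m = c * fm_integ f m + d * fm_integ g m.
Proof. induction m as [|p m IH]; simpl; [|rewrite IH]; ring. Qed.

Lemma fm_integ_le f g m :
  fm_positive m -> (forall x, f x <= g x) -> fm_integ f m <= fm_integ g m.
Proof.
  intros Hm H; induction Hm as [|p m Hp Hm IH]; simpl; [lra|].
  pose proof (Rmult_le_compat_l _ _ _ Hp (H (fst p))); lra.
Qed.

Lemma fm_integ_abs f m :
  fm_positive m -> Rabs (fm_integ f m) <= fm_integ (fun x => Rabs (f x)) m.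
Proof.
  intros Hm; induction Hm as [|p m Hp Hm IH]; simpl; [rewrite Rabs_R0; lra|].
  eapply Rle_trans; [apply Rabs_triang|].
  rewrite Rabs_mult, (Rabs_right (snd p)); lra.
Qed.

Lemma fm_integ_swap (f : R -> R -> R) a b :
  fm_integ (fun x => fm_integ (f x) b) a = fm_integ (fun y => fm_integ (fun x => f x y) a) b.
Proof.
  induction a as [|p a IH]; simpl.
  - induction b as [|q b IH]; simpl; [|rewrite <- IH]; ring.
  - rewrite IH; clear IH; induction b as [|q b IH]; simpl; [ring|].
    rewrite <- IH; ring.
Qed.

Lemma fm_integ_conv f a b :
  fm_integ f (fm_conv a b) = fm_integ (fun x => fm_integ (fun y => f (x + y)) b) a.
Proof.
  induction a as [|p a IH]; [reflexivity|].
  unfold fm_conv in *; simpl; rewrite fm_integ_app, IH; f_equal; clear IH.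
  induction b as [|q b IH]; simpl; [|rewrite IH]; ring.
Qed.

Lemma fm_integ_dirac0 f : fm_integ f fm_dirac0 = f 0.
Proof. unfold fm_dirac0; simpl; ring. Qed.

(** Equality of the measures rather than of the lists: the order and the splitting of atoms are
    invisible to integrals. *)
Definition fm_eq (a b : fmeas) : Prop := forall f, fm_integ f a = fm_integ f b.

Lemma fm_eq_conv a a' b b' :
  fm_eq a a' -> fm_eq b b' -> fm_eq (fm_conv a b) (fm_conv a' b').
Proof.
  intros Ha Hb f; rewrite !fm_integ_conv, Ha; apply fm_integ_ext; intros x; apply Hb.
Qed.

Lemma fm_conv_comm a b : fm_eq (fm_conv a b) (fm_conv b a).
Proof.
  intros f; rewrite !fm_integ_conv, fm_integ_swap.
  apply fm_integ_ext; intros x; apply fm_integ_ext; intros y; f_equal; ring.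
Qed.

Lemma fm_conv_assoc a b c : fm_eq (fm_conv a (fm_conv b c)) (fm_conv (fm_conv a b) c).
Proof.
  intros f; rewrite !fm_integ_conv; apply fm_integ_ext; intros x.
  rewrite fm_integ_conv; apply fm_integ_ext; intros y; apply fm_integ_ext; intros z.
  f_equal; ring.
Qed.

Lemma fm_conv_dirac0_l a : fm_eq (fm_conv fm_dirac0 a) a.
Proof.
  intros f; rewrite fm_integ_conv, fm_integ_dirac0; apply fm_integ_ext; intros x; f_equal; ring.
Qed.

Definition fm_conv_list (l : list fmeas) : fmeas := fold_right fm_conv fm_dirac0 l.

Lemma fm_conv_list_app l1 l2 :
  fm_eq (fm_conv_list (l1 ++ l2)) (fm_conv (fm_conv_list l1) (fm_conv_list l2)).
Proof.
  induction l1 as [|a l1 IH]; simpl; intros f.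
  - now rewrite fm_conv_dirac0_l.
  - rewrite <- fm_conv_assoc; now apply fm_eq_conv.
Qed.

Lemma fm_conv_list_concat ll :
  fm_eq (fm_conv_list (concat ll)) (fm_conv_list (map fm_conv_list ll)).
Proof.
  induction ll as [|l ll IH]; simpl; intros f; [reflexivity|].
  rewrite fm_conv_list_app; now apply fm_eq_conv.
Qed.

Lemma fm_conv_list_perm l1 l2 :
  Permutation l1 l2 -> fm_eq (fm_conv_list l1) (fm_conv_list l2).
Proof.
  intros H; induction H as [|a l1 l2 _ IH|a b l|l1 l2 l3 _ IH1 _ IH2]; simpl; intros f.
  - reflexivity.
  - now apply fm_eq_conv.
  - rewrite !fm_conv_assoc; apply fm_eq_conv; [apply fm_conv_comm|intros g; reflexivity].
  - now rewrite IH1.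
Qed.

Lemma fm_conv_family_list eta n :
  fm_eq (fm_conv_family eta n) (fm_conv_list (map eta (seq 0 n))).
Proof.
  induction n as [|n IH]; intros f; [reflexivity|].
  rewrite seq_S, map_app, fm_conv_list_app; simpl.
  apply fm_eq_conv; [exact IH|]; intros g.
  now rewrite fm_conv_comm, fm_conv_dirac0_l.
Qed.

(** * Hyperbolic functions, admissibility and basic bounds on [T] *)

Lemma cosh_plus x y : cosh (x + y) = cosh x * cosh y + sinh x * sinh y.
Proof. unfold cosh, sinh; rewrite Ropp_plus_distr, !exp_plus; field. Qed.

Lemma sinh_plus x y : sinh (x + y) = sinh x * cosh y + cosh x * sinh y.
Proof. unfold cosh, sinh; rewrite Ropp_plus_distr, !exp_plus; field. Qed.

Lemma cosh_pos x : 0 < cosh x.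
Proof. unfold cosh; pose proof (exp_pos x); pose proof (exp_pos (- x)); lra. Qed.

Lemma abs_sinh_le_cosh x : Rabs (sinh x) <= cosh x.
Proof.
  unfold cosh, sinh; pose proof (exp_pos x); pose proof (exp_pos (- x)); apply Rabs_le; lra.
Qed.

Lemma T_sinh m : T m = fm_integ (fun x => Rabs (sinh x)) m.
Proof.
  unfold T.
  rewrite (fm_integ_ext (fun x => Rabs (sinh x))
             (fun x => / 2 * Rabs (exp x - exp (- x)) + 0 * 0)), fm_integ_linear; [ring|].
  intros x; unfold sinh, Rdiv; rewrite Rabs_mult, (Rabs_right (/ 2)); lra.
Qed.

Lemma T_fm_eq a b : fm_eq a b -> T a = T b.
Proof. intros H; unfold T; now rewrite H. Qed.

Lemma admissible_positive m : admissible m -> fm_positive m.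
Proof. now intros []. Qed.

Lemma admissible_cosh m : admissible m -> fm_integ cosh m = 1.
Proof.
  intros (_ & H1 & H2).
  rewrite (fm_integ_ext cosh (fun x => / 2 * exp x + / 2 * exp (- x))).
  - rewrite fm_integ_linear, H1, H2; field.
  - intros x; unfold cosh; field.
Qed.

Lemma admissible_sinh m : admissible m -> fm_integ sinh m = 0.
Proof.
  intros (_ & H1 & H2).
  rewrite (fm_integ_ext sinh (fun x => / 2 * exp x + - / 2 * exp (- x))).
  - rewrite fm_integ_linear, H1, H2; field.
  - intros x; unfold sinh; field.
Qed.

Lemma fm_positive_conv a b : fm_positive a -> fm_positive b -> fm_positive (fm_conv a b).
Proof.
  intros Ha Hb; apply Forall_flat_map; eapply Forall_impl; [|exact Ha].
  intros p Hp; apply Forall_map; eapply Forall_impl; [|exact Hb].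
  intros q Hq; now apply Rmult_le_pos.
Qed.

Lemma admissible_conv a b : admissible a -> admissible b -> admissible (fm_conv a b).
Proof.
  intros (Pa & Ha & Ha') (Pb & Hb & Hb').
  split; [now apply fm_positive_conv|]; rewrite !fm_integ_conv; split.
  - rewrite <- Ha; apply fm_integ_ext; intros x.
    rewrite (fm_integ_ext _ (fun y => exp x * exp y + 0 * 0)), fm_integ_linear, Hb; [ring|].
    intros y; rewrite exp_plus; ring.
  - rewrite <- Ha'; apply fm_integ_ext; intros x.
    rewrite (fm_integ_ext _ (fun y => exp (- x) * exp (- y) + 0 * 0)), fm_integ_linear, Hb';
      [ring|].
    intros y; rewrite Ropp_plus_distr, exp_plus; ring.
Qed.

Lemma admissible_dirac0 : admissible fm_dirac0.
Proof.
  split; [repeat constructor; simpl; lra|]; rewrite !fm_integ_dirac0, Ropp_0, exp_0; lra.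
Qed.

Lemma admissible_conv_list l : Forall admissible l -> admissible (fm_conv_list l).
Proof.
  intros H; induction H; simpl; [exact admissible_dirac0|now apply admissible_conv].
Qed.

Lemma T_nonneg m : fm_positive m -> 0 <= T m.
Proof.
  intros H; rewrite T_sinh.
  apply Rle_trans with (fm_integ (fun x => 0 * 0 + 0 * 0) m).
  - rewrite (fm_integ_linear 0 0 (fun _ => 0) (fun _ => 0)); lra.
  - apply fm_integ_le; [exact H|]; intros x; pose proof (Rabs_pos (sinh x)); lra.
Qed.

Lemma T_le_1 m : admissible m -> T m <= 1.
Proof.
  intros H; rewrite T_sinh, <- (admissible_cosh m H).
  apply fm_integ_le; [now apply admissible_positive|exact abs_sinh_le_cosh].
Qed.

(** Triangle inequality in the addition formula for [sinh]; each [cosh] factor integrates to 1. *)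
Lemma T_conv_le a b : admissible a -> admissible b -> T (fm_conv a b) <= T a + T b.
Proof.
  intros Ha Hb; rewrite !T_sinh, fm_integ_conv.
  apply Rle_trans with
    (fm_integ (fun x => 1 * Rabs (sinh x) + fm_integ (fun y => Rabs (sinh y)) b * cosh x) a).
  - apply fm_integ_le; [now apply admissible_positive|]; intros x.
    replace (1 * Rabs (sinh x)) with (Rabs (sinh x) * fm_integ cosh b)
      by (rewrite (admissible_cosh b Hb); ring).
    rewrite (Rmult_comm _ (cosh x)), <- fm_integ_linear.
    apply fm_integ_le; [now apply admissible_positive|]; intros y.
    rewrite sinh_plus; eapply Rle_trans; [apply Rabs_triang|].
    rewrite !Rabs_mult, !(Rabs_right (cosh _)); [lra|..]; left; apply cosh_pos.
  - rewrite fm_integ_linear, (admissible_cosh a Ha); lra.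
Qed.

(** Averaging [sinh (x + y)] over [y] in [b] returns [sinh x], since [cosh] has integral 1 and
    [sinh] integral 0; then the absolute value is moved inside the integral. *)
Lemma T_conv_ge a b : admissible a -> admissible b -> T a <= T (fm_conv a b).
Proof.
  intros Ha Hb; rewrite !T_sinh, fm_integ_conv.
  apply fm_integ_le; [now apply admissible_positive|]; intros x.
  eapply Rle_trans; [|apply fm_integ_abs; now apply admissible_positive].
  rewrite (fm_integ_ext _ (fun y => sinh x * cosh y + cosh x * sinh y)).
  - rewrite fm_integ_linear, (admissible_cosh b Hb), (admissible_sinh b Hb); right.
    f_equal; ring.
  - intros y; apply sinh_plus.
Qed.

(** * Riesz products *)

(* The positive and negative parts of [sinh] have equal integrals, so subtracting from the
   indicator of [x > 0] its [cosh]-mean centres it and leaves half of [T m]. *)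
Lemma centred_test m c :
  admissible m -> 0 <= c <= 1 ->
  exists f : R -> R, (forall x, Rabs (f x) <= 1) /\
    fm_integ (fun x => f x * cosh x) m = 0 /\
    fm_integ (fun x => f x * sinh x) m = c * (T m / 2).
Proof.
  intros Hm Hc.
  set (h := fun x => if Rlt_dec 0 x then 1 else 0).
  set (p := fm_integ (fun x => h x * cosh x) m).
  assert (Hh : forall x, 0 <= h x <= 1) by (intros x; unfold h; destruct Rlt_dec; lra).
  pose proof (admissible_positive m Hm) as Pm.
  assert (Hp : 0 <= p <= 1).
  { split.
    - apply Rle_trans with (fm_integ (fun x => 0 * 0 + 0 * 0) m).
      + rewrite (fm_integ_linear 0 0 (fun _ => 0) (fun _ => 0)); lra.
      + apply fm_integ_le; [exact Pm|]; intros x.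
        pose proof (cosh_pos x); specialize (Hh x); nra.
    - rewrite <- (admissible_cosh m Hm); apply fm_integ_le; [exact Pm|]; intros x.
      pose proof (cosh_pos x); specialize (Hh x); nra. }
  exists (fun x => c * (h x - p)); repeat split.
  - intros x; specialize (Hh x); apply Rabs_le; nra.
  - rewrite (fm_integ_ext _ (fun x => c * (h x * cosh x) + (- c * p) * cosh x))
      by (intros; ring).
    rewrite fm_integ_linear, (admissible_cosh m Hm); fold p; ring.
  - rewrite (fm_integ_ext _ (fun x => c / 2 * Rabs (sinh x) + (c / 2 - c * p) * sinh x)).
    + rewrite fm_integ_linear, (admissible_sinh m Hm), <- T_sinh; field.
    + intros x; unfold h; destruct (Rlt_dec 0 x) as [Hx|Hx].
      * rewrite Rabs_right; [field|]; left; rewrite <- sinh_0; now apply sinh_lt.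
      * rewrite Rabs_left1; [field|].
        destruct (Req_dec x 0) as [->|]; [rewrite sinh_0; lra|].
        left; rewrite <- sinh_0; apply sinh_lt; lra.
Qed.

Definition sum_T (l : list fmeas) : R := fold_right (fun m acc => T m + acc) 0 l.

Lemma sum_T_nonneg l : Forall admissible l -> 0 <= sum_T l.
Proof.
  intros H; induction H as [|m l Hm Hl IH]; simpl; [lra|].
  pose proof (T_nonneg m (admissible_positive m Hm)); lra.
Qed.

(* [P + i Q] is the product of the [1 + i a c T(m) / 2] over [m] in [l].  The left side of the
   inequality integrates [sinh (y + x)] against the imaginary part of the Riesz product
   [(u + i v) (1 + i a f_1) ... (1 + i a f_k)], of modulus at most 1, with [f_j] the centred
   tests. *)
Lemma riesz_lower l a c :
  Forall admissible l -> 0 <= a -> 0 <= c <= 1 ->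
  exists P Q : R,
    (forall y u v, (u * u + v * v) * (1 + a * a) ^ length l <= 1 ->
       cosh y * u * Q + sinh y * v * P
         <= fm_integ (fun x => Rabs (sinh (y + x))) (fm_conv_list l)) /\
    (forall tau, tau = a * c * (sum_T l / 2) -> tau <= / 2 ->
       1 - tau * tau / 2 <= P <= 1 /\ 7 / 8 * tau <= Q <= tau).
Proof.
  intros Hl Ha Hc; induction Hl as [|m l Hm Hl (P & Q & IH & IHb)]; simpl.
  - exists 1, 0; split.
    + intros y u v Huv; rewrite !Rplus_0_r, Rmult_1_l.
      assert (Hv : Rabs v <= 1) by (apply Rabs_le; split; nra).
      replace (_ + _) with (v * sinh y) by ring.
      eapply Rle_trans; [apply Rle_abs|]; rewrite Rabs_mult.
      pose proof (Rabs_pos (sinh y)); nra.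
    + intros tau ->; lra.
  - destruct (centred_test m c Hm Hc) as (f & Hf & Hf0 & Hf1).
    set (th := c * (T m / 2)) in *.
    exists (P - a * th * Q), (Q + a * th * P); split.
    + intros y u v Huv; rewrite fm_integ_conv.
      (* The induction hypothesis is used at [y + x] with [u + i v] multiplied by [1 + i a f(x)],
         whose squared modulus is at most [1 + a * a]. *)
      apply Rle_trans with (fm_integ (fun x =>
        cosh (y + x) * (u - v * a * f x) * Q + sinh (y + x) * (v + u * a * f x) * P) m).
      (* Grouped by [cosh x], [sinh x], [f x * sinh x] and [f x * cosh x], whose integrals are 1, 0,
         [th] and 0. *)
      * rewrite (fm_integ_ext _ (fun x =>
          1 * (1 * ((cosh y * u * Q + sinh y * v * P) * cosh x
                    + (sinh y * u * Q + cosh y * v * P) * sinh x)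
           + (cosh y * u * P - sinh y * v * Q) * a * (f x * sinh x))
          + (sinh y * u * P - cosh y * v * Q) * a * (f x * cosh x))).
        2: { intros x; rewrite cosh_plus, sinh_plus; ring. }
        rewrite !fm_integ_linear, (admissible_cosh m Hm), (admissible_sinh m Hm), Hf0, Hf1.
        right; ring.
      * apply fm_integ_le; [now apply admissible_positive|]; intros x.
        eapply Rle_trans; [apply IH|].
        -- eapply Rle_trans; [|exact Huv].
           rewrite <- Rmult_assoc; apply Rmult_le_compat_r; [apply pow_le; nra|].
           assert (f x * f x <= 1).
           { specialize (Hf x); unfold Rabs in Hf; destruct (Rcase_abs (f x)); nra. }
           replace (_ + _) with ((u * u + v * v) * (1 + a * a * (f x * f x))) by ring.
           apply Rmult_le_compat_l; [nra|].
           assert (0 <= a * a) by nra; nra.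
        -- right; apply fm_integ_ext; intros z; do 2 f_equal; ring.
    + intros tau Htau Htau2.
      assert (Hth : 0 <= a * th).
      { pose proof (T_nonneg m (admissible_positive m Hm)); unfold th.
        apply Rmult_le_pos; [lra|]; apply Rmult_le_pos; lra. }
      pose proof (sum_T_nonneg l Hl) as HS.
      assert (Ht : 0 <= a * c * (sum_T l / 2)).
      { repeat apply Rmult_le_pos; lra. }
      assert (Hsum : tau = a * c * (sum_T l / 2) + a * th) by (rewrite Htau; unfold th; field).
      destruct (IHb _ eq_refl) as (HP & HQ).
      { lra. }
      set (t := a * c * (sum_T l / 2)) in *; set (b := a * th) in *.
      clearbody t b; clear Htau; subst tau.
      assert (t * t <= / 4) by nra.
      assert (0 <= Q) by lra; assert (b * Q <= b * t) by nra.
      assert (0 <= b * Q) by nra.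
      (* The constant is [1 - (1/2)^2 / 2], the lower bound on [P] when the partial sum [t] is at
         most 1/2. *)
      assert (7 / 8 * b <= b * P <= b) by nra.
      repeat split; nra.
Qed.

Lemma pow_one_plus_le_exp x n : 0 <= x -> (1 + x) ^ n <= exp (INR n * x).
Proof.
  intros Hx; induction n as [|n IH]; [simpl; rewrite Rmult_0_l, exp_0; lra|].
  replace (INR (S n) * x) with (x + INR n * x) by (rewrite S_INR; ring).
  rewrite exp_plus; simpl.
  apply Rmult_le_compat; [lra|apply pow_le; lra|apply exp_ineq1_le|exact IH].
Qed.

(** For non-empty [l] one may take [a = 1 / sqrt (length l)]: the sum is then at most
    [4 * sqrt (length l)] times [T] of the convolution, where monotonicity alone gives the factor
    [length l]. *)
Lemma sum_T_le l a :
  Forall admissible l -> 0 <= a -> INR (length l) * (a * a) <= 1 ->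
  T (fm_conv_list l) < / 4 -> a * sum_T l <= 4 * T (fm_conv_list l).
Proof.
  intros Hl Ha Hla Ht.
  assert (HN : (1 + a * a) ^ length l <= 3).
  { eapply Rle_trans; [apply pow_one_plus_le_exp; nra|].
    eapply Rle_trans; [|exact exp_le_3].
    destruct Hla as [Hla| ->]; [left; now apply exp_increasing|lra]. }
  assert (Hc : forall c tau, 0 <= c <= 1 -> tau = a * c * (sum_T l / 2) -> tau <= / 2 ->
                 tau / 2 <= T (fm_conv_list l)).
  { intros c tau Hc Htau Htau2.
    destruct (riesz_lower l a c Hl Ha Hc) as (P & Q & H1 & H2).
    destruct (H2 tau Htau Htau2) as (_ & HQ).
    specialize (H1 0 (4 / 7) 0); rewrite cosh_0, sinh_0 in H1.
    rewrite T_sinh, (fm_integ_ext _ (fun x => Rabs (sinh (0 + x))))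
      by (intros; rewrite Rplus_0_l; reflexivity).
    eapply Rle_trans; [|apply H1; lra]; lra. }
  destruct (Rle_dec (a * (sum_T l / 2)) (/ 2)) as [Hs|Hs].
  - specialize (Hc 1 (a * (sum_T l / 2))); lra.
  (* If the total overshoots 1/2, the tests are shrunk so that [tau] is exactly 1/2; this forces [T]
     to be at least 1/4, a contradiction. *)
  - apply Rnot_le_lt in Hs.
    specialize (Hc (/ (a * sum_T l)) (/ 2)).
    assert (/ 2 / 2 <= T (fm_conv_list l)); [|lra].
    apply Hc; [|field; split; nra|lra].
    split; [left; apply Rinv_0_lt_compat; lra|].
    rewrite <- Rinv_1; apply Rinv_le_contravar; lra.
Qed.

Module Homogenization.
Import all_boot fingroup perm.

Set Implicit Arguments.
Unset Strict Implicit.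
Unset Printing Implicit Defensive.
Local Open Scope R_scope.

(** * Finite sums of reals *)

HB.instance Definition _ := Monoid.isComLaw.Build R 0 Rplus
  (fun x y z => esym (Rplus_assoc x y z)) Rplus_comm Rplus_0_l.

Lemma sumR_le I (r : seq I) (f g : I -> R) :
  (forall i, f i <= g i) -> \big[Rplus/0]_(i <- r) f i <= \big[Rplus/0]_(i <- r) g i.
Proof.
by move=> fg; apply: (big_ind2 Rle) => //; [lra | move=> *; apply: Rplus_le_compat].
Qed.

Lemma sumR_scal I (r : seq I) c (f : I -> R) :
  \big[Rplus/0]_(i <- r) (c * f i) = c * \big[Rplus/0]_(i <- r) f i.
Proof. by rewrite (big_morph _ (Rmult_plus_distr_l c) (Rmult_0_r c)). Qed.

Lemma sumR_const I (r : seq I) c : \big[Rplus/0]_(i <- r) c = INR (size r) * c.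
Proof.
elim: r => [|i r IH]; first by rewrite big_nil /=; ring.
by rewrite big_cons IH -[size (i :: r)]/(size r).+1 S_INR; ring.
Qed.

Lemma sumR_const_fin (I : finType) c : \big[Rplus/0]_(i : I) c = INR #|I| * c.
Proof.
rewrite big_const; elim: #|I| => [|k IH]; first by rewrite /=; ring.
by rewrite iterS IH S_INR; ring.
Qed.

Lemma sumR_iotaS N (f : nat -> R) :
  \big[Rplus/0]_(k <- iota 1 N.+1) f k = \big[Rplus/0]_(k <- iota 1 N) f k + f N.+1.
Proof. by rewrite -(addn1 N) iotaD big_cat big_seq1 add1n addn1. Qed.

(** * Averages over uniform random words *)

Section WordAverage.
Variable n : nat.
Hypothesis n_gt0 : (0 < n)%N.
Implicit Types (w : seq 'I_n) (phi psi : seq 'I_n -> R).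

(* Expectation over words of [k] independent uniform letters. *)
Fixpoint wavg k phi : R :=
  if k is k'.+1 then / INR n * \big[Rplus/0]_(i : 'I_n) wavg k' (fun w => phi (i :: w))
  else phi [::].

Lemma INRn_gt0 : 0 < INR n.
Proof. by apply: lt_0_INR; apply/ltP. Qed.

Lemma wavg_le k phi psi :
  (forall w, size w = k -> phi w <= psi w) -> wavg k phi <= wavg k psi.
Proof.
elim: k phi psi => [|k IH] phi psi le /=; first exact: le.
apply: Rmult_le_compat_l; first by left; apply: Rinv_0_lt_compat INRn_gt0.
by apply: sumR_le => i; apply: IH => w sw; apply: le; rewrite /= sw.
Qed.

Lemma eq_wavg k phi psi : phi =1 psi -> wavg k phi = wavg k psi.
Proof.
move=> e; apply: Rle_antisym; apply: wavg_le => w _; rewrite e; exact: Rle_refl.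
Qed.

Lemma wavg_linear k c d phi psi :
  wavg k (fun w => c * phi w + d * psi w) = c * wavg k phi + d * wavg k psi.
Proof.
elim: k phi psi => [|k IH] phi psi //=.
under eq_bigr do rewrite IH.
by rewrite big_split /= !sumR_scal; ring.
Qed.

Lemma wavg_const k c : wavg k (fun=> c) = c.
Proof.
elim: k => [|k IH] //=; rewrite IH sumR_const_fin card_ord.
by field; have := INRn_gt0; lra.
Qed.

Lemma wavg_sum I (r : seq I) k (phi : I -> seq 'I_n -> R) :
  wavg k (fun w => \big[Rplus/0]_(i <- r) phi i w) = \big[Rplus/0]_(i <- r) wavg k (phi i).
Proof.
elim: r => [|i r IH].
  by rewrite big_nil -[RHS](wavg_const k 0); apply: eq_wavg => w; rewrite big_nil.
rewrite big_cons -IH -[wavg k (phi i)]Rmult_1_l -[X in _ + X]Rmult_1_l -wavg_linear.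
by apply: eq_wavg => w; rewrite big_cons; ring.
Qed.

(** Relabelling the letters preserves the uniform law, which allows [F] to be averaged over all
    permutations first. *)
Lemma wavg_perm k (s : {perm 'I_n}) phi : wavg k (fun w => phi (map s w)) = wavg k phi.
Proof.
elim: k phi => [|k IH] phi //=; congr (_ * _).
rewrite [RHS](reindex_inj (@perm_inj _ s)); apply: eq_bigr => i _.
exact: (IH (fun w => phi (s i :: w))).
Qed.

(** The letters are independent, and each contributes the mean factor [(n - 1) / n + 4 / n]. *)
Lemma wavg_count k (i : 'I_n) :
  wavg k (fun w => 4 ^ count_mem i w) = (1 + 3 / INR n) ^ k.
Proof.
elim: k => [|k IH] //=.
have step (j : 'I_n) : wavg k (fun w => 4 ^ ((j == i) + count_mem i w)) =
    (1 + 3 / INR n) ^ k * 4 ^ (j == i).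
  rewrite (@eq_wavg k _ (fun w => 4 ^ (j == i) * 4 ^ count_mem i w + 0 * 0)).
    rewrite (wavg_linear k (4 ^ (j == i)) 0 (fun w => 4 ^ count_mem i w) (fun=> 0)) IH.
    ring.
  by move=> w; rewrite pow_add; ring.
rewrite (eq_bigr _ (fun j _ => step j)).
rewrite sumR_scal (bigD1 i) //= eqxx /=.
have -> : \big[Rplus/0]_(j | j != i) 4 ^ (j == i) = INR n - 1.
  rewrite (eq_bigr (fun=> 1)) => [|j /negbTE-> //].
  have := sumR_const_fin 'I_n 1; rewrite (bigD1 i) //= card_ord.
  set S := BigBody; lra.
by field; have := INRn_gt0; lra.
Qed.

End WordAverage.

(** * Permutations of the letters and layers of a word *)

(** Serves to realise a rotation of a list of all letters by a permutation, which carries one block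
    onto another. *)
Lemma perm_of_lists (I : finType) (s1 s2 : seq I) :
  uniq s1 -> uniq s2 -> s1 =i predT -> s2 =i predT -> exists r : {perm I}, map r s1 = s2.
Proof.
move=> u1 u2 m1 m2.
have sz : size s1 = size s2 by apply/perm_size/uniq_perm => // x; rewrite m1 m2.
case: (posnP (size s2)) => [s20|s2_gt0].
  by exists 1%g; move: sz; rewrite s20 (size0nil s20) => /size0nil->.
have x0 : I by case: (s2) s2_gt0.
have ltn2 x : (index x s1 < size s2)%N by rewrite -sz index_mem m1.
have inj : injective (fun x => nth x0 s2 (index x s1)).
  move=> x y /eqP; rewrite nth_uniq // => /eqP e.
  by rewrite -(nth_index x0 (m1 x : x \in s1)) e nth_index // m1.
exists (perm inj); apply: (@eq_from_nth _ x0) => [|k]; rewrite size_map // => ltk.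
by rewrite (nth_map x0) // permE index_uniq.
Qed.

Definition layer (I : finType) k (w : seq I) : seq I :=
  [seq i <- enum I | (k <= count_mem i w)%N].

(** A letter occurring [c] times lies once in each of the layers 1 to [c], and [c] is at most
    [size w]. *)
Lemma perm_layers (I : finType) (w : seq I) :
  perm_eq w (flatten [seq layer k w | k <- iota 1 (size w)]).
Proof.
apply/allP => i _ /=; apply/eqP; rewrite count_flatten -map_comp.
rewrite (eq_map (_ : _ =1 (fun k => nat_of_bool (k <= count_mem i w)%N))); last first.
  move=> k; rewrite /= /layer count_uniq_mem; last exact/filter_uniq/enum_uniq.
  by rewrite mem_filter mem_enum andbT.
have := count_size (pred1 i) w; move: (count_mem i w) (size w) => c N.
elim: N => [|N IH]; first by rewrite leqn0 => /eqP.
rewrite -addn1 iotaD map_cat sumn_cat /= addn0 add1n.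
rewrite leq_eqVlt => /orP[/eqP->|]; last first.
  by rewrite addn1 ltnS => le; rewrite -IH // ltnNge le addn0.
rewrite addn1 leqnn addn1; congr _.+1.
have e : {in iota 1 N, (fun k => (k <= N.+1)%N : nat) =1 (fun=> 1%N)}.
  by move=> k; rewrite mem_iota add1n ltnS => /andP[_ le]; rewrite (leq_trans le).
by rewrite ((eq_in_map _ _ _).1 e) sumnE big_map sum1_size size_iota.
Qed.

(** * Cost of the layers, averaged over permutations *)

(* [F w] plays the role of [T] of the convolution of the [eta i], [i] in [w]. *)
Section Layers.
Variable n : nat.
Hypothesis n_gt0 : (0 < n)%N.
Variable F : seq 'I_n -> R.
Let t := F (enum 'I_n).
Hypothesis F_perm : forall s1 s2, perm_eq s1 s2 -> F s1 = F s2.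
Hypothesis F_nil : F [::] = 0.
Hypothesis F_sub : forall s1 s2, F (s1 ++ s2) <= F s1 + F s2.
Hypothesis F_mono : forall s1 s2, F s1 <= F (s1 ++ s2).
Hypothesis F_blocks : forall (ss : seq (seq 'I_n)) a,
  0 <= a -> INR (size ss) * (a * a) <= 1 -> F (flatten ss) < / 4 ->
  a * \big[Rplus/0]_(s <- ss) F s <= 4 * F (flatten ss).
Hypothesis t_lt : t < / 4.

Let nfact : R := INR #|{perm 'I_n}|.

(** A list without repetitions extends to an enumeration of all letters, so monotonicity applies. *)
Lemma F_uniq_le s : uniq s -> F s <= t.
Proof.
move=> us; rewrite /t (@F_perm (enum 'I_n) (s ++ [seq i <- enum 'I_n | i \notin s])).
  exact: F_mono.
apply: uniq_perm; first exact: enum_uniq; last move=> i.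
  rewrite cat_uniq us filter_uniq ?enum_uniq // andbT.
  by apply/hasPn => i; rewrite mem_filter => /andP[].
by rewrite mem_enum mem_cat mem_filter mem_enum andbT orbN.
Qed.

Lemma F_flatten ss : F (flatten ss) <= \big[Rplus/0]_(s <- ss) F s.
Proof.
elim: ss => [|s ss IH] /=; first by rewrite big_nil F_nil; lra.
by rewrite big_cons; have := F_sub s (flatten ss); lra.
Qed.

(** All [m] disjoint blocks have the same permutation average as [A], and [F_blocks] bounds their
    sum, so this average is at most [4 * t / sqrt m]. The free parameter [c] makes the bound linear
    in [size A], ready for taking expectations. *)
Lemma perm_avg_le (A : seq 'I_n) c : uniq A -> (0 < size A)%N -> 0 < c ->
  \big[Rplus/0]_(s : {perm 'I_n}) F (map s A)
    <= nfact * (4 * t * (c / 2 + INR (size A) / (INR n * c))).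
Proof.
move=> uA sA_gt0 c_gt0; set s := size A; pose m := (n %/ s)%N.
pose L := A ++ [seq i <- enum 'I_n | i \notin A].
have uL : uniq L.
  rewrite cat_uniq uA filter_uniq ?enum_uniq // andbT.
  by apply/hasPn => i; rewrite mem_filter => /andP[].
have mL : L =i predT by move=> i; rewrite mem_cat mem_filter mem_enum andbT orbN.
have sL : size L = n.
  rewrite -[RHS](size_enum_ord n); apply/perm_size/uniq_perm => //; first exact: enum_uniq.
  by move=> i; rewrite mL mem_enum.
have les : (s <= n)%N by rewrite -sL size_cat leq_addr.
pose B j := take s (drop (j * s)%N L).
have B_avg j : (j < m)%N ->
    \big[Rplus/0]_(r : {perm 'I_n}) F (map r (B j)) = \big[Rplus/0]_(r : {perm 'I_n}) F (map r A).
  (* Rotating [L] by [j * s] brings block [j] to the front, where [A] stands in [L]; hence [B j] is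
     the image of [A] under [r], and composition with [r] reindexes the sum. *)
  move=> ltjm; have [r er] : exists r : {perm 'I_n}, map r L = rot (j * s) L.
    by apply: perm_of_lists; rewrite ?rot_uniq // => i; rewrite mem_rot mL.
  have -> : B j = map r A.
    rewrite -[in RHS](take_size_cat [seq i <- enum 'I_n | i \notin A] (erefl (size A))).
    rewrite map_take -/L er /rot takel_cat // size_drop sL leq_subRL.
      by rewrite addnC -mulSn (leq_trans _ (leq_divM n s)) // leq_mul2r ltjm orbT.
    by rewrite (leq_trans _ (leq_divM n s)) // leq_mul2r ltnW ?orbT.
  rewrite [RHS](reindex_inj (mulgI r)); apply: eq_bigr => q _; congr F.
  by rewrite -map_comp; apply: eq_map => x /=; rewrite permM.
have flatB k : flatten [seq B j | j <- iota 0 k] = take (k * s) L.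
  elim: k => [|k IH]; first by rewrite take0.
  by rewrite -addn1 iotaD map_cat flatten_cat IH /= cats0 mulnDl mul1n takeD.
have m_gt0 : 0 < INR m by apply/lt_0_INR/ltP; rewrite divn_gt0.
have q_gt0 := sqrt_lt_R0 _ m_gt0; have qq := sqrt_sqrt _ (Rlt_le _ _ m_gt0).
set q := sqrt (INR m) in q_gt0 qq.
have B_sum (r : {perm 'I_n}) :
    \big[Rplus/0]_(j <- iota 0 m) F (map r (B j)) <= 4 * t * q.
  (* The concatenated blocks are an initial segment of [L], hence without repetitions. *)
  have fl : F (flatten [seq map r (B j) | j <- iota 0 m]) <= t.
    rewrite (map_comp (map r) B) -map_flatten flatB; apply: F_uniq_le.
    by rewrite map_inj_uniq ?take_uniq //; apply: perm_inj.
  set S := \big[_/_]_(j <- _) _.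
  have blk : / q * S <= 4 * t.
    have := @F_blocks [seq map r (B j) | j <- iota 0 m] (/ q).
    rewrite big_map size_map size_iota => blk.
    apply: Rle_trans (blk _ _ (Rle_lt_trans _ _ _ fl t_lt)) _.
    - by left; apply: Rinv_0_lt_compat.
    - by right; rewrite -qq; field; lra.
    - by apply: Rmult_le_compat_l fl; lra.
  have := Rmult_le_compat_r q _ _ (Rlt_le _ _ q_gt0) blk.
  by have -> : / q * S * q = S by field; lra.
set X := \big[_/_]_r _.
have mX : q * q * X <= nfact * (4 * t * q).
  rewrite qq -[in INR m](size_iota 0 m) -sumR_const.
  have -> : \big[Rplus/0]_(j <- iota 0 m) X =
    \big[Rplus/0]_(j <- iota 0 m) \big[Rplus/0]_(r : {perm 'I_n}) F (map r (B j)).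
    by apply: eq_big_seq => j; rewrite mem_iota add0n => /andP[_ ltjm]; rewrite B_avg.
  rewrite exchange_big /= -sumR_const_fin; exact: sumR_le.
have t_ge0 : 0 <= t by rewrite -F_nil; apply: (@F_mono [::] _).
have nf_ge0 : 0 <= nfact by apply: pos_INR.
(* The remainder of [n] modulo [s] is below [s], hence at most [m * s] because [m] is at least 1. *)
have n_le : INR n <= 2 * (q * q) * INR s.
  have -> : 2 = INR 2 by rewrite /=; lra.
  rewrite qq -!mult_INR; apply: le_INR; apply/leP; rewrite !multE [leqLHS](divn_eq n s) -/m.
  rewrite mul2n -addnn mulnDl leq_add2l (leq_trans (ltnW (ltn_pmod n sA_gt0))) //.
  by rewrite leq_pmull // divn_gt0.
have n0 := INRn_gt0 n_gt0.
(* AM-GM, with [INR m >= INR n / (2 * INR s)] *)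
have bound : / q <= c / 2 + INR s / (INR n * c).
  have h : / (2 * (q * q)) <= INR s / INR n.
    apply: (Rmult_le_reg_r (2 * (q * q) * INR n)); first by nra.
    have -> : / (2 * (q * q)) * (2 * (q * q) * INR n) = INR n by field; lra.
    by apply: Rle_trans n_le _; right; field; lra.
  have h2 : / (2 * (q * q)) * / c <= INR s / (INR n * c).
    have -> : INR s / (INR n * c) = INR s / INR n * / c by field; lra.
    by apply: Rmult_le_compat_r h; left; apply: Rinv_0_lt_compat.
  apply: Rle_trans (Rplus_le_compat_l _ _ _ h2).
  apply: (Rmult_le_reg_r (2 * q * q * c)); first by apply: Rmult_lt_0_compat; nra.
  have -> : / q * (2 * q * q * c) = 2 * q * c by field; lra.
  have -> : (c / 2 + / (2 * (q * q)) * / c) * (2 * q * q * c) = (q * c) * (q * c) + 1.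
    by field; lra.
  have := Rle_0_sqr (q * c - 1); rewrite /Rsqr; lra.
have -> : X = / q * / q * (q * q * X) by field; lra.
apply: Rle_trans (_ : nfact * (4 * t * / q) <= _).
  have -> : nfact * (4 * t * / q) = / q * / q * (nfact * (4 * t * q)) by field; lra.
  apply: Rmult_le_compat_l mX; have := Rinv_0_lt_compat _ q_gt0; nra.
apply: Rmult_le_compat_l => //; apply: Rmult_le_compat_l bound; lra.
Qed.

(** Exchanging sums, each letter with [c] occurrences contributes a geometric sum of [4 ^ k] over
    [k] from 1 to at most [c]. *)
Lemma layer_sum_le (w : seq 'I_n) N :
  \big[Rplus/0]_(k <- iota 1 N) (4 ^ k * INR (size (layer k w)))
    <= 4 / 3 * \big[Rplus/0]_(i : 'I_n) 4 ^ count_mem i w.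
Proof.
have geom c M : \big[Rplus/0]_(k <- iota 1 M) (4 ^ k * INR (k <= c)%N) <= 4 / 3 * 4 ^ minn M c.
  elim: M => [|M IH]; first by rewrite big_nil min0n /=; lra.
  rewrite sumR_iotaS.
  have p4 : 0 < 4 ^ M by apply: pow_lt; lra.
  case: (leqP M.+1 c) => le.
    move: IH; rewrite (minn_idPl (ltnW le)) /=; lra.
  move: IH; rewrite (minn_idPr _) //=; lra.
have -> : \big[Rplus/0]_(k <- iota 1 N) (4 ^ k * INR (size (layer k w))) =
    \big[Rplus/0]_(i : 'I_n) \big[Rplus/0]_(k <- iota 1 N) (4 ^ k * INR (k <= count_mem i w)%N).
  rewrite exchange_big /=; apply: eq_bigr => k _; rewrite sumR_scal; congr (_ * _).
  rewrite /layer size_filter -big_enum /=; elim: (enum 'I_n) => [|i s IH]; first by rewrite big_nil.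
  by rewrite big_cons -IH /= plus_INR.
rewrite -sumR_scal; apply: sumR_le => i; apply: Rle_trans (geom _ _) _.
apply: Rmult_le_compat_l; first by lra.
by apply: Rle_pow; [lra | apply/leP; apply: geq_minr].
Qed.

(* The layer weights come from AM-GM with parameter [480 / 4 ^ k]. *)
Lemma cost_sum_le N :
  \big[Rplus/0]_(k <- iota 1 N) (if (k <= 5)%N then 1 else 960 / 4 ^ k) <= 5 + 5 / 16.
Proof.
(* Closed form of the partial sum: from [k = 6] on the tail is geometric, with total
   [320 / 4 ^ 5 = 5 / 16]. Keeping the term [320 / 4 ^ N] lets the induction close. *)
apply: Rle_trans (_ : (if (N <= 5)%N then INR N else 5 + 5 / 16 - 320 / 4 ^ N) <= _).
  elim: N => [|N IH]; first by rewrite big_nil /=; lra.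
  rewrite sumR_iotaS; move: IH; set S := \big[_/_]_(_ <- _) _.
  rewrite S_INR (_ : 4 ^ N.+1 = 4 * 4 ^ N) //.
  case: (ltngtP N 5) => [lt|gt|->] le; [lra | | rewrite /= in le *; lra].
  have p4 := pow_lt 4 N ltac:(lra).
  have -> : 960 / (4 * 4 ^ N) = 240 / 4 ^ N by field; lra.
  have -> : 320 / (4 * 4 ^ N) = 80 / 4 ^ N by field; lra.
  lra.
case: leqP => [/leP/le_INR /=|_]; first by lra.
by have := Rinv_0_lt_compat _ (pow_lt 4 N ltac:(lra)); lra.
Qed.

Lemma perm_avg_word_le (w : seq 'I_n) :
  \big[Rplus/0]_(r : {perm 'I_n}) F (map r w)
    <= nfact * (t * (5 + 5 / 16) + t / (90 * INR n) * \big[Rplus/0]_(i : 'I_n) 4 ^ count_mem i w).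
Proof.
have t_ge0 : 0 <= t by rewrite -F_nil; apply: (@F_mono [::] _).
have nf_ge0 : 0 <= nfact by apply: pos_INR.
have n0 := INRn_gt0 n_gt0.
(* With [c = 480 / 4 ^ k], the term [4 * t * c / 2] of [perm_avg_le] is [960 * t / 4 ^ k], and the
   other one is the second summand. By [layer_sum_le] the factor 1/120 later becomes
   [4/3 * 1/120 = 1/90]. *)
pose b k := t * (if (k <= 5)%N then 1 else 960 / 4 ^ k)
            + t / (120 * INR n) * (4 ^ k * INR (size (layer k w))).
apply: Rle_trans (_ : \big[Rplus/0]_(k <- iota 1 (size w)) (nfact * b k) <= _).
  apply: Rle_trans (_ : \big[Rplus/0]_(r : {perm 'I_n})
    \big[Rplus/0]_(k <- iota 1 (size w)) F (map r (layer k w)) <= _).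
    apply: sumR_le => r.
    rewrite (@F_perm _ (flatten [seq map r (layer k w) | k <- iota 1 (size w)])).
      by apply: Rle_trans (F_flatten _) _; rewrite big_map; apply: Rle_refl.
    by rewrite (map_comp (map r)) -map_flatten; apply/perm_map/perm_layers.
  rewrite exchange_big /=; apply: sumR_le => k; rewrite /b.
  have p4 := pow_lt 4 k ltac:(lra).
  have sz0 := pos_INR (size (layer k w)).
  have u : uniq (layer k w) by apply/filter_uniq/enum_uniq.
  have rest_ge0 : 0 <= t / (120 * INR n) * (4 ^ k * INR (size (layer k w))).
    apply: Rmult_le_pos; last by nra.
    by apply: Rle_mult_inv_pos; lra.
  case: leqP => _.
    apply: Rle_trans (_ : nfact * t <= _); last by apply: Rmult_le_compat_l; lra.
    rewrite /nfact -sumR_const_fin; apply: sumR_le => r; apply: F_uniq_le.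
    by rewrite map_inj_uniq //; apply: perm_inj.
  (* An empty layer is set apart, as it has no blocks to replace it. *)
  case: (posnP (size (layer k w))) => [/size0nil->|sz].
    rewrite /= (eq_bigr (fun=> 0)) => [|r _]; last by rewrite F_nil.
    rewrite sumR_const_fin !Rmult_0_r Rplus_0_r; do 2 (apply: Rmult_le_pos => //).
    by apply: Rle_mult_inv_pos; lra.
  have c_gt0 : 0 < 480 / 4 ^ k by apply: Rdiv_lt_0_compat; lra.
  apply: Rle_trans (perm_avg_le u sz c_gt0) _; right; congr (_ * _).
  by move: (4 ^ k) p4 (t) (INR (size _)) (INR n) n0 => p p4 t' l n' n0'; field; lra.
rewrite sumR_scal; apply: Rmult_le_compat_l => //.
rewrite /b big_split /= !sumR_scal; apply: Rplus_le_compat.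
  by apply: Rmult_le_compat_l => //; apply: cost_sum_le.
apply: Rle_trans (Rmult_le_compat_l _ _ _ _ (layer_sum_le w (size w))) _.
  by apply: Rle_mult_inv_pos; lra.
by right; move: (t) (INR n) n0 (\big[_/_]_i _) => t' n' n0' S; field; lra.
Qed.

(** The mean of [4 ^ count_mem i w] is [(1 + 3 / n) ^ n], at most the cube of [exp 1] and so at most
    27. The total factor is [5 + 5/16 + 27/90 = 5.6125]. *)
Lemma wavg_le_six : wavg n F <= 6 * t.
Proof.
have t_ge0 : 0 <= t by rewrite -F_nil; apply: (@F_mono [::] _).
have n0 := INRn_gt0 n_gt0.
have nf_gt0 : 0 < nfact.
  by apply/lt_0_INR/ltP; apply/card_gt0P; exists 1%g.
have : nfact * wavg n F <= nfact * (t * (5 + 5 / 16) + t / (90 * INR n) * (INR n * 27)).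
  rewrite -sumR_const_fin (eq_bigr (fun r : {perm 'I_n} => wavg n (fun w => F (map r w)))).
    rewrite -wavg_sum //; apply: Rle_trans (wavg_le n_gt0 (fun w _ => perm_avg_word_le w)) _.
    have -> : wavg n (fun w => nfact * (t * (5 + 5 / 16) +
        t / (90 * INR n) * \big[Rplus/0]_(i : 'I_n) 4 ^ count_mem i w)) =
      wavg n (fun w => nfact * (t * (5 + 5 / 16)) * 1 +
        nfact * (t / (90 * INR n)) * \big[Rplus/0]_(i : 'I_n) 4 ^ count_mem i w).
      by apply: eq_wavg => // w; ring.
    rewrite wavg_linear wavg_const // wavg_sum // (eq_bigr (fun=> (1 + 3 / INR n) ^ n)).
      rewrite sumR_const_fin card_ord Rmult_1_r Rmult_assoc -Rmult_plus_distr_l.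
      apply: Rmult_le_compat_l; first by lra.
      apply: Rplus_le_compat_l; apply: Rmult_le_compat_l; first by apply: Rle_mult_inv_pos; lra.
      apply: Rmult_le_compat_l; first by lra.
      apply: Rle_trans (pow_one_plus_le_exp _ n _) _; first by apply: Rle_mult_inv_pos; lra.
      have -> : INR n * (3 / INR n) = 1 + (1 + 1) by field; lra.
      rewrite !exp_plus; have := exp_le_3; have := exp_pos 1; nra.
    by move=> i _; apply: wavg_count.
  by move=> r _; rewrite wavg_perm.
move/(Rmult_le_reg_l _ _ _ nf_gt0) => le; apply: Rle_trans le _.
have -> : t / (90 * INR n) * (INR n * 27) = t * (27 / 90).
  by move: (t) (INR n) n0 => t' n' n0'; field; lra.
lra.
Qed.

End Layers.

(** * Powers of the mixture as word averages, and the conclusion for measures *)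

Lemma fm_integ_wavg n k (phi : R -> seq 'I_n -> R) m : (0 < n)%N ->
  fm_integ (fun x => wavg k (phi x)) m = wavg k (fun w => fm_integ (fun x => phi x w) m).
Proof.
move=> n_gt0; elim: m => [|[x c] m IH]; first by rewrite wavg_const.
rewrite [LHS]/= IH -[X in _ + X]Rmult_1_l -wavg_linear.
by apply: eq_wavg => // w /=; ring.
Qed.

Lemma fm_integ_mixture f c eta n :
  fm_integ f (fm_scale c (fm_sum eta n)) = c * \big[Rplus/0]_(i : 'I_n) fm_integ f (eta i).
Proof.
have scale m : fm_integ f (fm_scale c m) = c * fm_integ f m.
  by elim: m => [|p m /= ->] /=; ring.
rewrite scale; congr (_ * _); elim: n => [|n IH]; first by rewrite big_ord0.
by rewrite big_ord_recr -IH /= fm_integ_app.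
Qed.

(** Expanding by multilinearity, each convolution factor picks one of the [eta i] uniformly and
    independently. *)
Lemma fm_integ_mixture_pow f eta n k : (0 < n)%N ->
  fm_integ f (fm_conv_pow (fm_scale (/ INR n) (fm_sum eta n)) k) =
  wavg k (fun w : seq 'I_n => fm_integ f (fm_conv_list [seq eta i | i : 'I_n <- w])).
Proof.
move=> n_gt0; elim: k f => [|k IH] f //.
rewrite [fm_conv_pow _ _]/= fm_integ_conv fm_integ_mixture /=; congr (_ * _).
apply: eq_bigr => i _.
rewrite (fm_integ_ext _ _ _ (fun x => IH (fun y => f (x + y)))) fm_integ_wavg //.
by apply: eq_wavg => // w; rewrite fm_integ_conv.
Qed.

Lemma perm_eq_Permutation (I : eqType) (s1 s2 : seq I) : perm_eq s1 s2 -> Permutation s1 s2.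
Proof.
move=> e; apply: (@catCA_perm_ind _ (Permutation s1)) e _ => // a b c h.
apply: Permutation_trans h _; rewrite !catA.
exact: Permutation_app_tail (Permutation_app_comm _ _).
Qed.

Lemma homogenization n eta : (0 < n)%N -> (forall i, (i < n)%N -> admissible (eta i)) ->
  T (fm_conv_pow (fm_scale (/ INR n) (fm_sum eta n)) n) <= 6 * T (fm_conv_family eta n).
Proof.
move=> n_gt0 adm.
pose M (w : seq 'I_n) := fm_conv_list [seq eta i | i : 'I_n <- w].
have admM w : admissible (M w).
  by apply: admissible_conv_list; elim: w => [|i w IH] /=; constructor => //; apply: adm.
have M_cat s1 s2 : fm_eq (M (s1 ++ s2)) (fm_conv (M s1) (M s2)).
  by rewrite /M map_cat; apply: fm_conv_list_app.
have M_perm s1 s2 : perm_eq s1 s2 -> fm_eq (M s1) (M s2).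
  by move=> e; apply/fm_conv_list_perm/Permutation_map/perm_eq_Permutation.
have -> : T (fm_conv_pow (fm_scale (/ INR n) (fm_sum eta n)) n) = wavg n (fun w => T (M w)).
  by rewrite T_sinh fm_integ_mixture_pow //; apply: eq_wavg => // w; rewrite T_sinh.
have -> : T (fm_conv_family eta n) = T (M (enum 'I_n)).
  rewrite (T_fm_eq _ _ (fm_conv_family_list eta n)) /M.
  by rewrite (map_comp eta val) val_enum_ord.
(* When [T] of the full convolution is at least 1/4, six times it exceeds 1, which bounds every
   [T (M w)]. *)
have [small|big] := Rlt_le_dec (T (M (enum 'I_n))) (/ 4); last first.
  have := wavg_le n_gt0 (fun w (_ : size w = n) => T_le_1 _ (admM w)).
  by rewrite wavg_const //; lra.
apply: (@wavg_le_six n n_gt0 (fun w => T (M w))) => //.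
- by move=> s1 s2 /M_perm; apply: T_fm_eq.
- by rewrite T_sinh fm_integ_dirac0 sinh_0 Rabs_R0.
- by move=> s1 s2; rewrite (T_fm_eq _ _ (M_cat s1 s2)); apply: T_conv_le.
- by move=> s1 s2; rewrite (T_fm_eq _ _ (M_cat s1 s2)); apply: T_conv_ge.
move=> ss a a_ge0.
have eM : fm_eq (M (flatten ss)) (fm_conv_list [seq M s | s <- ss]).
  rewrite /M map_flatten (map_comp fm_conv_list) => f.
  by rewrite -fm_conv_list_concat.
have -> : \big[Rplus/0]_(s <- ss) T (M s) = sum_T [seq M s | s <- ss].
  by elim: ss {eM} => [|s ss IH]; rewrite ?big_nil // big_cons IH.
rewrite (T_fm_eq _ _ eM) -(size_map M) => le lt4.
apply: sum_T_le => //; by elim: ss {eM le lt4} => [|s ss IH] /=; constructor.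
Qed.

End Homogenization.

Theorem theorem2 :
  exists C0 : R, C0 < 6.7129 /\
    forall (n : nat) (eta : nat -> fmeas),
      (1 <= n)%nat ->
      (forall i, (i < n)%nat -> admissible (eta i)) ->
      T (fm_conv_pow (fm_scale (/ INR n) (fm_sum eta n)) n)
        <= C0 * T (fm_conv_family eta n).
Proof.
  exists 6; split; [lra|]; intros n eta Hn Hadm.
  apply Homogenization.homogenization.
  - now apply (ssrbool.introT ssrnat.leP).
  - intros i Hi; apply Hadm; exact (ssrbool.elimT ssrnat.leP Hi).
Qed.
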